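(* Let $\mathbb{F}$ be a field and let $\mathcal{V}$ be an action accessible, operadic, quadratic variety of non-associative algebras over $\mathbb{F}$. Suppose that $\mathcal{V}$ is not the variety $\mathbf{AbAlg}$ of abelian algebras (determined by $xy=0$). (1) If $\mathcal{V}$ is commutative (i.e. $xy=yx$ is an identity of $\mathcal{V}$), then $\mathcal{V}$ is one of the following varieties: the variety $\mathbf{JJord}$ of Jacobi--Jordan algebras, the variety $\mathbf{CAssoc}$ of commutative associative algebras, their intersection $\mathbf{JJord}\cap\mathbf{CAssoc}$, or the variety $\mathbf{Nil}_2(\mathbf{Com})$ of two-step nilpotent commutative algebras. (2) If $\mathcal{V}$ is anti-commutative (i.e. $xy=-yx$ is an identity of $\mathcal{V}$), then $\mathcal{V}$ is one of the following varieties: the variety $\mathbf{Lie}$ of Lie algebras, the variety $\mathbf{ACAAssoc}$ of anti-commutative anti-associative algebras, their intersection $\mathbf{Lie}\cap\mathbf{ACAAssoc}$, or the variety $\mathbf{Nil}_2(\mathbf{ACom})$ of two-step nilpotent anti-commutative algebras.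
   Context: An algebra over $\mathbb{F}$ is a vector space with a bilinear multiplication (no unit or associativity assumed); morphisms are linear maps preserving the multiplication. A non-associative polynomial is an element of the free non-associative algebra on a set of variables; it is an identity of an algebra $A$ if it vanishes under every substitution of elements of $A$. A variety is the class of all algebras satisfying a given set of identities. A polynomial in $x_1,\dots,x_n$ is multilinear if every monomial in it contains each $x_i$ exactly once. A variety is operadic if it is determined by a set of multilinear polynomials, and quadratic if there is a set of identities of degree 2 or 3 that generates all of its identities. Action accessible: for each object $X$ of $\mathcal{V}$, every split extension with kernel $X$ (a diagram $X\xrightarrow{k}A\rightleftarrows B$ with $\alpha\colon A\to B$, $\beta\colon B\to A$, $\alpha\beta=1_B$, $k$ a kernel of $\alpha$) admits a morphism (a morphism of split extensions which is the identity on $X$) into a faithful one, i.e. into a subterminal object of the category of split extensions with kernel $X$ (one into which there is at most one morphism from any other object). It is known that an operadic variety $\mathcal{V}$ is action accessible if and only if there exist $\lambda_1,\dots,\lambda_8,\mu_1,\dots,\mu_8\in\mathbb{F}$ such that $$x(yz)=\lambda_1(xy)z+\lambda_2(yx)z+\lambda_3z(xy)+\lambda_4z(yx)+\lambda_5(xz)y+\lambda_6(zx)y+\lambda_7y(xz)+\lambda_8y(zx)$$ and $$(yz)x=\mu_1(xy)z+\mu_2(yx)z+\mu_3z(xy)+\mu_4z(yx)+\mu_5(xz)y+\mu_6(zx)y+\mu_7y(xz)+\mu_8y(zx)$$ are identities of $\mathcal{V}$. Varieties: $\mathbf{JJord}$: $xy=yx$ and $x(yz)+y(zx)+z(xy)=0$.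 $\mathbf{CAssoc}$: $xy=yx$ and $x(yz)=(xy)z$. $\mathbf{Lie}$: $xy+yx=0$ and $x(yz)+y(zx)+z(xy)=0$. $\mathbf{ACAAssoc}$: $xy=-yx$ and $x(yz)=-(xy)z$. $\mathbf{Nil}_2(\mathbf{Com})$: $xy=yx$ and $x(yz)=0=(xy)z$. $\mathbf{Nil}_2(\mathbf{ACom})$: $xy=-yx$ and $x(yz)=0=(xy)z$. *)

(* Defs.v *)
From HB Require Import structures.
From mathcomp Require Import all_boot all_order all_algebra finmap.
From mathcomp Require Import monalg.

Set Implicit Arguments.
Unset Strict Implicit.
Unset Printing Implicit Defensive.

Import GRing.Theory.
Local Open Scope ring_scope.

Reserved Notation "x ** y" (at level 40, left associativity).

HB.mixin Record Lmodule_isNaAlgebra (F : fieldType) A of GRing.Lmodule F A := {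
  namul : A -> A -> A;
  namul_linl : forall (a : F) (x y z : A),
    namul (a *: x + y) z = a *: namul x z + namul y z;
  namul_linr : forall (a : F) (x y z : A),
    namul z (a *: x + y) = a *: namul z x + namul z y
}.

#[short(type="naAlgType")]
HB.structure Definition NaAlgebra (F : fieldType) :=
  {A of GRing.Lmodule F A & Lmodule_isNaAlgebra F A}.

Notation "x ** y" := (namul x y) : ring_scope.

Record naHom (F : fieldType) (A B : naAlgType F) := NaHom {
  naHom_fun :> {linear A -> B};
  naHomM : {morph naHom_fun : x y / x ** y}
}.

(** Non-associative monomials: binary trees with leaves in the countable set of
    variables [x_0, x_1, ...]. *)

Inductive namon := NaVar of nat | NaMul of namon & namon.

Fixpoint namon_encode (m : namon) : GenTree.tree nat :=
  match m with
  | NaVar i => GenTree.Leaf i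
  | NaMul m1 m2 => GenTree.Node 0 [:: namon_encode m1; namon_encode m2]
  end.

Fixpoint namon_decode (t : GenTree.tree nat) : option namon :=
  match t with
  | GenTree.Leaf i => Some (NaVar i)
  | GenTree.Node _ [:: t1; t2] =>
      if namon_decode t1 is Some m1 then
        if namon_decode t2 is Some m2 then Some (NaMul m1 m2) else None
      else None
  | _ => None
  end.

Lemma namon_encodeK : pcancel namon_encode namon_decode.
Proof. by elim=> //= m1 -> m2 ->. Qed.

HB.instance Definition _ := Countable.copy namon (pcan_type namon_encodeK).

Fixpoint mvars (m : namon) : seq nat :=
  match m with
  | NaVar i => [:: i]
  | NaMul m1 m2 => mvars m1 ++ mvars m2
  end.

Definition namon_deg (m : namon) : nat := size (mvars m).

(** The free non-associative algebra [{malg F[namon]}]: the free module on the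
    monomials, with the bilinear extension of [NaMul]. *)

Section FreeNaAlgebra.
Variable F : fieldType.

Definition linext (M : lmodType F) (f : namon -> M) (p : {malg F[namon]}) : M :=
  \sum_(m <- msupp p) p@_m *: f m.

Lemma linextEw (M : lmodType F) (f : namon -> M) (p : {malg F[namon]})
    (d : {fset namon}) :
  (msupp p `<=` d)%fset -> linext f p = \sum_(m <- d) p@_m *: f m.
Proof.
move=> sd; apply: big_fset_incl => // m _ /mcoeff_outdom ->.
by rewrite scale0r.
Qed.

Lemma linext_lin (M : lmodType F) (f : namon -> M) (a : F)
    (p q : {malg F[namon]}) :
  linext f (a *: p + q) = a *: linext f p + linext f q.
Proof.
pose d := (msupp (a *: p + q) `|` (msupp p `|` msupp q))%fset.
have sd1 : (msupp (a *: p + q) `<=` d)%fset by exact: fsubsetUl.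
have sd2 : (msupp p `<=` d)%fset.
  by apply: fsubset_trans (fsubsetUl _ (msupp q)) (fsubsetUr _ _).
have sd3 : (msupp q `<=` d)%fset.
  by apply: fsubset_trans (fsubsetUr (msupp p) _) (fsubsetUr _ _).
rewrite (linextEw f sd1) (linextEw f sd2) (linextEw f sd3).
rewrite scaler_sumr -big_split /=; apply: eq_bigr => m _.
by rewrite mcoeffD mcoeffZ scalerDl scalerA.
Qed.

Definition free_mul (p q : {malg F[namon]}) : {malg F[namon]} :=
  linext (fun m => linext (fun n => << NaMul m n >>) q) p.

Lemma free_mul_linl (a : F) (x y z : {malg F[namon]}) :
  free_mul (a *: x + y) z = a *: free_mul x z + free_mul y z.
Proof. exact: linext_lin. Qed.

Lemma free_mul_linr (a : F) (x y z : {malg F[namon]}) :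
  free_mul z (a *: x + y) = a *: free_mul z x + free_mul z y.
Proof.
rewrite /free_mul {1 3 5}/linext scaler_sumr -big_split /=.
by apply: eq_bigr => m _; rewrite linext_lin scalerDr !scalerA mulrC.
Qed.

HB.instance Definition _ :=
  Lmodule_isNaAlgebra.Build F {malg F[namon]} free_mul_linl free_mul_linr.

End FreeNaAlgebra.

Notation napoly F := {malg F[namon]}.

Section Varieties.
Variable F : fieldType.

Fixpoint mon_eval (A : naAlgType F) (v : nat -> A) (m : namon) : A :=
  match m with
  | NaVar i => v i
  | NaMul m1 m2 => mon_eval v m1 ** mon_eval v m2
  end.

Definition na_eval (A : naAlgType F) (v : nat -> A) (p : napoly F) : A :=
  linext (mon_eval v) p.

Definition identity_in (A : naAlgType F) (p : napoly F) : Prop :=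
  forall v : nat -> A, na_eval v p = 0.

Definition naClass : Type := naAlgType F -> Prop.

Definition same_class (V W : naClass) : Prop := forall A, V A <-> W A.

Definition class_meet (V W : naClass) : naClass := fun A => V A /\ W A.

Definition determined_by (S : napoly F -> Prop) (V : naClass) : Prop :=
  forall A : naAlgType F, V A <-> (forall p, S p -> identity_in A p).

Definition is_variety (V : naClass) : Prop := exists S, determined_by S V.

Definition identity_of (V : naClass) (p : napoly F) : Prop :=
  forall A : naAlgType F, V A -> identity_in A p.

(** The variables of the polynomial are taken to be [x_0, ..., x_(n-1)]. *)
Definition multilinear (p : napoly F) : Prop :=
  exists n : nat,
    forall m, m \in msupp p -> perm_eq (mvars m) (iota 0 n).

Definition operadic (V : naClass) : Prop :=
  exists S : napoly F -> Prop,
    (forall p, S p -> multilinear p) /\ determined_by S V.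

(** Substitution of polynomials for variables is evaluation in the free
    algebra, so a T-ideal is an ideal stable under all endomorphisms. *)
Definition T_ideal (I : napoly F -> Prop) : Prop :=
  [/\ I 0,
      forall (a : F) p q, I p -> I q -> I (a *: p + q),
      forall p q, I p -> I (p ** q) /\ I (q ** p)
    & forall (s : nat -> napoly F) p, I p -> I (na_eval s p)].

Definition T_ideal_gen (S : napoly F -> Prop) (p : napoly F) : Prop :=
  forall I, T_ideal I -> (forall q, S q -> I q) -> I p.

(** "Identity of degree 2 or 3" bounds the degree of every monomial: with a
    bound on the top degree only, the identity [x_0 + x_0 ** x_1] would make
    the zero variety quadratic. *)
Definition quadratic (V : naClass) : Prop :=
  exists S : napoly F -> Prop,
    (forall p, S p ->
       forall m, m \in msupp p -> namon_deg m = 2%N \/ namon_deg m = 3%N) /\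
    (forall p, identity_of V p <-> T_ideal_gen S p).

Section SplitExtensions.
Variables (V : naClass) (X : naAlgType F).

(** Kernels are taken in the category [V]. *)
Definition is_kernel (A B : naAlgType F) (k : naHom X A) (alpha : naHom A B) :=
  (forall x, alpha (k x) = 0) /\
  (forall (C : naAlgType F) (f : naHom C A), V C ->
     (forall c, alpha (f c) = 0) ->
     exists g : naHom C X,
       (forall c, k (g c) = f c) /\
       (forall g' : naHom C X, (forall c, k (g' c) = f c) -> g' =1 g)).

Record splitExt := SplitExt {
  se_mid : naAlgType F;
  se_base : naAlgType F;
  se_midV : V se_mid;
  se_baseV : V se_base;
  se_k : naHom X se_mid;
  se_alpha : naHom se_mid se_base;
  se_beta : naHom se_base se_mid;
  se_section : forall b, se_alpha (se_beta b) = b;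
  se_kernel : is_kernel se_k se_alpha
}.

Record splitExtHom (E E' : splitExt) := SplitExtHom {
  seh_mid : naHom (se_mid E) (se_mid E');
  seh_base : naHom (se_base E) (se_base E');
  seh_k : forall x, seh_mid (se_k E x) = se_k E' x;
  seh_alpha : forall a, se_alpha E' (seh_mid a) = seh_base (se_alpha E a);
  seh_beta : forall b, seh_mid (se_beta E b) = se_beta E' (seh_base b)
}.

Definition faithful_ext (E : splitExt) : Prop :=
  forall (E' : splitExt) (h h' : splitExtHom E' E),
    seh_mid h =1 seh_mid h' /\ seh_base h =1 seh_base h'.

End SplitExtensions.

Definition action_accessible (V : naClass) : Prop :=
  forall X : naAlgType F, V X ->
  forall E : splitExt V X,
  exists E' : splitExt V X, faithful_ext E' /\ inhabited (splitExtHom E E').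

Definition is_commutative (A : naAlgType F) : Prop :=
  forall x y : A, x ** y = y ** x.

Definition is_anticommutative (A : naAlgType F) : Prop :=
  forall x y : A, x ** y = - (y ** x).

Definition AbAlg : naClass := fun A => forall x y : A, x ** y = 0.

Definition JJord : naClass := fun A =>
  is_commutative A /\
  forall x y z : A, x ** (y ** z) + y ** (z ** x) + z ** (x ** y) = 0.

Definition CAssoc : naClass := fun A =>
  is_commutative A /\ forall x y z : A, x ** (y ** z) = (x ** y) ** z.

Definition Lie : naClass := fun A =>
  (forall x y : A, x ** y + y ** x = 0) /\
  forall x y z : A, x ** (y ** z) + y ** (z ** x) + z ** (x ** y) = 0.

Definition ACAAssoc : naClass := fun A =>
  is_anticommutative A /\
  forall x y z : A, x ** (y ** z) = - ((x ** y) ** z).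

Definition Nil2Com : naClass := fun A =>
  is_commutative A /\
  forall x y z : A, x ** (y ** z) = 0 /\ (x ** y) ** z = 0.

Definition Nil2ACom : naClass := fun A =>
  is_anticommutative A /\
  forall x y z : A, x ** (y ** z) = 0 /\ (x ** y) ** z = 0.

End Varieties.

(* Main.v *)
(** Put [eps = 1] in the commutative case and [eps = -1] in the anti-commutative
    one, so that [x ** y = eps *: (y ** x)] in V.

    The multilinear identities of V of degree 3 reduce to
    [a x(yz) + b y(zx) + c z(xy) = 0] and form a subrepresentation of [F^3]
    under S_3: it is zero, the line [a = b = c] (Jacobi), the plane
    [a + b + c = 0] ([x(yz) = y(zx)]) or everything; in characteristic 3 the
    line lies in the plane. Zero is excluded because the variety of all
    eps-commutative algebras is not action accessible.

    These identities determine V. If A satisfies those of degrees 2 and 3, then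
    A (x) t F[t] / (t^4) satisfies all multilinear identities of V, hence lies
    in V; evaluating a quadratic identity of V at elements [a_i (x) t]
    separates its components of degrees 2 and 3 and shows that it holds in A. *)

Require Import Defs.
From HB Require Import structures.
From mathcomp Require Import all_boot all_order all_algebra finmap.
From mathcomp Require Import monalg ring.
From Stdlib Require Import Classical.

Set Implicit Arguments.
Unset Strict Implicit.
Unset Printing Implicit Defensive.

Import GRing.Theory.
Local Open Scope ring_scope.

(** * Bilinear arithmetic *)

Section NaAlgebraTheory.
Variables (F : fieldType) (A : naAlgType F).
Implicit Types (a : F) (x y z : A).

Lemma namulDl x y z : (x + y) ** z = x ** z + y ** z.
Proof. by rewrite -[x]scale1r namul_linl !scale1r. Qed.

Lemma namulDr x y z : z ** (x + y) = z ** x + z ** y.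
Proof. by rewrite -[x]scale1r namul_linr !scale1r. Qed.

Lemma namul0l x : 0 ** x = 0 :> A.
Proof. by apply: (addrI (0 ** x)); rewrite -namulDl !addr0. Qed.

Lemma namul0r x : x ** 0 = 0 :> A.
Proof. by apply: (addrI (x ** 0)); rewrite -namulDr !addr0. Qed.

Lemma namulZl a x y : (a *: x) ** y = a *: (x ** y).
Proof. by rewrite -[a *: x]addr0 namul_linl namul0l addr0. Qed.

Lemma namulZr a x y : x ** (a *: y) = a *: (x ** y).
Proof. by rewrite -[a *: y]addr0 namul_linr namul0r addr0. Qed.

Lemma namul_suml (I : Type) (s : seq I) (f : I -> A) y :
  (\sum_(i <- s) f i) ** y = \sum_(i <- s) f i ** y.
Proof.
by elim: s => [|i s IH]; rewrite ?big_nil ?namul0l // !big_cons namulDl IH.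
Qed.

Lemma namul_sumr (I : Type) (s : seq I) (f : I -> A) y :
  y ** (\sum_(i <- s) f i) = \sum_(i <- s) y ** f i.
Proof.
by elim: s => [|i s IH]; rewrite ?big_nil ?namul0r // !big_cons namulDr IH.
Qed.

End NaAlgebraTheory.

(** * Evaluation of polynomials and the T-ideal of identities *)

Section Evaluation.
Variables (F : fieldType) (A : naAlgType F).
Implicit Types (v : nat -> A) (p q : napoly F).

Lemma linext_is_linear (M : lmodType F) (f : namon -> M) : linear (linext f).
Proof. by move=> a p q; apply: linext_lin. Qed.

HB.instance Definition _ (M : lmodType F) (f : namon -> M) :=
  GRing.isLinear.Build F {malg F[namon]} M *:%R (linext f)
    (linext_is_linear f).

Lemma linextU (M : lmodType F) (f : namon -> M) m : linext f << m >> = f m.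
Proof.
rewrite (@linextEw _ _ _ _ [fset m]%fset) ?msuppU ?oner_eq0 //.
by rewrite big_seq_fset1 mcoeffUU scale1r.
Qed.

Lemma na_evalM v p q : na_eval v (p ** q) = na_eval v p ** na_eval v q.
Proof.
rewrite /na_eval [p ** q]/(free_mul p q) /free_mul {2}/linext linear_sum.
rewrite {3}/linext namul_suml; apply: eq_bigr => m _.
rewrite linearZ /= namulZl; congr (_ *: _).
rewrite {2}/linext linear_sum namul_sumr; apply: eq_bigr => n _.
by rewrite linearZ /= namulZr linextU.
Qed.

Lemma na_eval_comp v (s : nat -> napoly F) p :
  na_eval v (na_eval s p) = na_eval (fun i => na_eval v (s i)) p.
Proof.
rewrite {2}/na_eval {1}/linext /na_eval linear_sum; apply: eq_bigr => m _.
rewrite linearZ; congr (_ *: _).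
by elim: m => //= m1 <- m2 <-; rewrite -!/(na_eval v _) -na_evalM.
Qed.

(** This is the T-ideal to which [T_ideal_gen] gets applied: an algebra satisfying the generators
    satisfies all that they generate. *)
Lemma T_ideal_identity_in : T_ideal (identity_in A).
Proof.
split=> [v|a p q pA qA v|p q pA|s p pA v].
- by rewrite /na_eval linear0.
- by rewrite /na_eval linext_lin -!/(na_eval v _) pA qA scaler0 addr0.
- by split=> v; rewrite na_evalM pA ?namul0l ?namul0r.
- by rewrite na_eval_comp pA.
Qed.

End Evaluation.

Section QuadraticVarieties.
Variables (F : fieldType) (V : naClass F).

(** Operadicity makes V the class of models of all its identities; quadraticity generates these from
    identities whose monomials have degree 2 or 3. *)
Lemma quadratic_models : operadic V -> quadratic V ->
  determined_by (fun p => identity_of V p /\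
    forall m, m \in msupp p -> namon_deg m = 2%N \/ namon_deg m = 3%N) V.
Proof.
move=> [S [_ SV]] [Q [Qdeg QV]] A; split=> [VA p [pV _]|QA]; first exact: pV.
apply/SV => p Sp; have /QV pQ : identity_of V p by move=> B /SV; apply.
apply: pQ (T_ideal_identity_in A) _ => q Qq; apply: QA; split; last exact: Qdeg.
by apply/QV => I _; apply.
Qed.

End QuadraticVarieties.

(** * Algebras with zero product *)

Section ZeroAlgebra.
Variables (F : fieldType) (M : lmodType F).

Definition zero_algebra : Type := M.

HB.instance Definition _ := GRing.Lmodule.on zero_algebra.

Definition zero_mul (x y : zero_algebra) : zero_algebra := 0.

Lemma zero_mul_linl a x y z :
  zero_mul (a *: x + y) z = a *: zero_mul x z + zero_mul y z.
Proof. by rewrite scaler0 addr0. Qed.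

Lemma zero_mul_linr a x y z :
  zero_mul z (a *: x + y) = a *: zero_mul z x + zero_mul z y.
Proof. by rewrite scaler0 addr0. Qed.

HB.instance Definition _ :=
  Lmodule_isNaAlgebra.Build F zero_algebra zero_mul_linl zero_mul_linr.

Lemma zero_mulE (x y : zero_algebra) : x ** y = 0.
Proof. by []. Qed.

End ZeroAlgebra.

(** * Reduction of polynomials to a spanning set of monomials *)

Section MonomialSpan.
Variable F : fieldType.

(** The coefficients [c] are the same for all algebras of the class and all valuations, so the
    reduced form can be moved from one algebra to another. *)
Lemma na_eval_span (C : naClass F) (es : seq namon) (p : napoly F) :
    uniq es ->
    (forall m, m \in msupp p -> exists2 e, e \in es & exists a : F,
       forall A, C A -> forall v : nat -> A,
         mon_eval v m = a *: mon_eval v e) ->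
  exists c : namon -> F, forall A, C A -> forall v : nat -> A,
    na_eval v p = \sum_(e <- es) c e *: mon_eval v e.
Proof.
move=> ues h; have {h}: forall m (mp : m \in enum_fset (msupp p)), _ := h.
rewrite /na_eval /linext; elim: (enum_fset (msupp p)) => [|m s IH] h.
  exists (fun=> 0) => A _ v; rewrite big_nil big1 // => e _.
  by rewrite scale0r.
have [|c cP] := IH; first by move=> n ns; apply: h; rewrite inE ns orbT.
have [|e ees [a aP]] := h m; first by rewrite inE eqxx.
exists (fun e' => c e' + (if e' == e then p@_m * a else 0)) => A CA v.
rewrite big_cons cP // aP // scalerA.
under [in RHS]eq_bigr do rewrite scalerDl.
rewrite big_split addrC /=; congr (_ + _).
rewrite (bigD1_seq e) //= eqxx big1 ?addr0 // => i /negPf ->.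
by rewrite scale0r.
Qed.

End MonomialSpan.

(** * Truncation, separating identities by degree *)

Section Truncation.
Variables (F : fieldType).

(** [truncation A] is A (x) t F[t] / (t^4), the triple (a, b, c) standing for
    a t + b t^2 + c t^3. *)
Definition truncation (A : naAlgType F) : Type := (A * A * A)%type.

HB.instance Definition _ A := GRing.Lmodule.on (truncation A).

Variable A : naAlgType F.

Definition trunc_mul (x y : truncation A) : truncation A :=
  (0, x.1.1 ** y.1.1, x.1.1 ** y.1.2 + x.1.2 ** y.1.1).

Lemma truncZ a (x y z : A) :
  a *: ((x, y, z) : truncation A) = (a *: x, a *: y, a *: z).
Proof. by []. Qed.

Lemma trunc_mul_linl a x y z :
  trunc_mul (a *: x + y) z = a *: trunc_mul x z + trunc_mul y z.
Proof.
case: x y z => [[x1 x2] x3] [[y1 y2] y3] [[z1 z2] z3].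
rewrite /trunc_mul !truncZ /= !namul_linl; congr (_, _, _).
  by rewrite scaler0 addr0.
by rewrite scalerDr addrACA.
Qed.

Lemma trunc_mul_linr a x y z :
  trunc_mul z (a *: x + y) = a *: trunc_mul z x + trunc_mul z y.
Proof.
case: x y z => [[x1 x2] x3] [[y1 y2] y3] [[z1 z2] z3].
rewrite /trunc_mul !truncZ /= !namul_linr; congr (_, _, _).
  by rewrite scaler0 addr0.
by rewrite scalerDr addrACA.
Qed.

HB.instance Definition _ :=
  Lmodule_isNaAlgebra.Build F (truncation A) trunc_mul_linl trunc_mul_linr.

Lemma truncM (x y : truncation A) : x ** y = trunc_mul x y.
Proof. by []. Qed.

End Truncation.

Section TruncationTheory.
Variables (F : fieldType) (A : naAlgType F).

Lemma namon_deg_gt0 m : (0 < namon_deg m)%N.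
Proof.
by elim: m => //= m1 h1 m2 _; rewrite /namon_deg /= size_cat addn_gt0 h1.
Qed.

Lemma namon_degM m1 m2 :
  namon_deg (NaMul m1 m2) = (namon_deg m1 + namon_deg m2)%N.
Proof. by rewrite /namon_deg /= size_cat. Qed.

Lemma namon_deg1 m : namon_deg m = 1%N -> exists i, m = NaVar i.
Proof.
case: m => [i _|m1 m2]; first by exists i.
rewrite namon_degM; have := namon_deg_gt0 m1; have := namon_deg_gt0 m2.
by case: (namon_deg m1) (namon_deg m2) => [|d] [|e] //; rewrite addnS.
Qed.

Lemma namon_deg2 m : namon_deg m = 2%N ->
  exists i j, m = NaMul (NaVar i) (NaVar j).
Proof.
case: m => // m1 m2; rewrite namon_degM.
have := namon_deg_gt0 m1; have := namon_deg_gt0 m2.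
case d1: (namon_deg m1) => [|[|d]] //; case d2: (namon_deg m2) => [|[|e]] //;
  rewrite ?addSn ?addnS // => _ _ _.
have [i ->] := namon_deg1 d1; have [j ->] := namon_deg1 d2.
by exists i, j.
Qed.

Lemma namon_deg3 m : namon_deg m = 3%N ->
  exists i j k, m = NaMul (NaVar i) (NaMul (NaVar j) (NaVar k)) \/
    m = NaMul (NaMul (NaVar i) (NaVar j)) (NaVar k).
Proof.
case: m => // m1 m2; rewrite namon_degM.
have := namon_deg_gt0 m1; have := namon_deg_gt0 m2.
case d1: (namon_deg m1) => [|[|[|d]]] //;
  case d2: (namon_deg m2) => [|[|[|e]]] //; rewrite ?addSn ?addnS // => _ _ _.
- have [i ->] := namon_deg1 d1; have [j [k ->]] := namon_deg2 d2.
  by exists i, j, k; left.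
- have [i [j ->]] := namon_deg2 d1; have [k ->] := namon_deg1 d2.
  by exists i, j, k; right.
Qed.

Lemma mon_eval_trunc (v : nat -> truncation A) m :
  [/\ (1 < namon_deg m)%N -> (mon_eval v m).1.1 = 0,
      (2 < namon_deg m)%N -> (mon_eval v m).1.2 = 0
    & (3 < namon_deg m)%N -> (mon_eval v m).2 = 0].
Proof.
elim: m => [i|m1 [h1 h1' h1''] m2 [h2 h2' h2'']]; first by split.
rewrite namon_degM /=; have g1 := namon_deg_gt0 m1; have g2 := namon_deg_gt0 m2.
case: (namon_deg m1) g1 h1 h1' => [|[|[|d]]] // _ h1 h1';
  case: (namon_deg m2) g2 h2 h2' => [|[|[|e]]] // _ h2 h2'; split=> //= _;
  try rewrite (h1 isT); try rewrite (h1' isT); try rewrite (h2 isT);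
  try rewrite (h2' isT); by rewrite ?namul0l ?namul0r ?addr0.
Qed.

Definition trunc_gen (w : nat -> A) (i : nat) : truncation A := (w i, 0, 0).

Lemma mon_eval_trunc_gen (w : nat -> A) m :
  mon_eval (trunc_gen w) m =
  (if namon_deg m == 1%N then mon_eval w m else 0,
   if namon_deg m == 2%N then mon_eval w m else 0,
   if namon_deg m == 3%N then mon_eval w m else 0).
Proof.
elim: m => [i|m1 IH1 m2 IH2] //=.
rewrite IH1 IH2 namon_degM /namul /= /trunc_mul /=.
have := namon_deg_gt0 m1; have := namon_deg_gt0 m2.
case: (namon_deg m1) => [|[|[|[|d]]]] //;
  case: (namon_deg m2) => [|[|[|[|e]]]] //= _ _;
  by rewrite ?addnS /= ?namul0l ?namul0r ?addr0 ?add0r.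
Qed.

(** The linear map adding the coefficients of t^2 and t^3 sends the value of [p] at the elements
    [w i] t to its value at the [w i], each monomial having degree 2 or 3. *)
Lemma na_eval_trunc_gen (w : nat -> A) (p : napoly F) :
    (forall m, m \in msupp p -> namon_deg m = 2%N \/ namon_deg m = 3%N) ->
    na_eval (trunc_gen w) p = 0 :> truncation A ->
  na_eval w p = 0.
Proof.
move=> pdeg; have : linear (fun x : truncation A => x.1.2 + x.2).
  by move=> a x y /=; rewrite scalerDr addrACA.
move=> flin; pose fL := GRing.isLinear.Build F (truncation A) A *:%R _ flin.
pose f : {linear truncation A -> A} :=
  HB.pack (fun x : truncation A => x.1.2 + x.2) fL.
move=> /(congr1 f); rewrite linear0 {1}/na_eval /linext linear_sum => <-.
rewrite /na_eval /linext; apply: eq_big_seq => m mp; rewrite linearZ /=.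
by rewrite mon_eval_trunc_gen /=; case: (pdeg m mp) => ->;
  rewrite /= ?addr0 ?add0r.
Qed.

End TruncationTheory.

(** * Normal forms of multilinear polynomials of degree at most 3 *)

Section CommutationSign.
Variables (F : fieldType) (eps : F).
Hypothesis eps2 : eps * eps = 1.

Definition sign_commutative : naClass F :=
  fun A => forall x y : A, x ** y = eps *: (y ** x).

Lemma sign_commutative_trunc A :
  sign_commutative A -> sign_commutative (truncation A).
Proof.
move=> AC x y; rewrite !truncM /trunc_mul truncZ; congr (_, _, _).
- by rewrite scaler0.
- exact: AC.
- by rewrite addrC scalerDr AC [in X in _ + X]AC.
Qed.

Lemma multilinear1_normal (p : napoly F) :
    (forall m, m \in msupp p -> perm_eq (mvars m) (iota 0 1)) ->
  exists a : F, forall (A : naAlgType F) (v : nat -> A),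
    na_eval v p = a *: v 0%N.
Proof.
move=> pm; have [//|m mp|c cP] := @na_eval_span F (fun=> True) [:: NaVar 0] p.
- exists (NaVar 0); first by rewrite inE.
  have /[dup] /perm_size /namon_deg1 [i ->] := pm m mp.
  move=> /perm_mem /(_ i); rewrite !inE eqxx => /esym /eqP ->.
  by exists 1 => A _ v; rewrite scale1r.
by exists (c (NaVar 0)) => A v; rewrite cP // big_seq1.
Qed.

Lemma multilinear2_normal (p : napoly F) :
    (forall m, m \in msupp p -> perm_eq (mvars m) (iota 0 2)) ->
  exists a : F, forall A, sign_commutative A ->
    forall v : nat -> A, na_eval v p = a *: (v 0%N ** v 1%N).
Proof.
pose e := NaMul (NaVar 0) (NaVar 1).
move=> pm; have [//|m mp|c cP] := @na_eval_span F sign_commutative [:: e] p.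
- exists e; first by rewrite inE.
  have /[dup] /perm_size /namon_deg2 [i [j ->]] := pm m mp.
  move=> /= pij; have := perm_mem pij i; have := perm_mem pij j.
  have := perm_uniq pij; rewrite /= !inE !eqxx orbT /= => neq /esym hj /esym hi.
  case/orP: hi neq => /eqP ->; case/orP: hj => /eqP -> // _.
    by exists 1 => A _ v; rewrite scale1r.
  by exists eps => A CA v; apply: CA.
by exists (c e) => A CA v; rewrite cP // big_seq1.
Qed.

Definition cyclic_combination (A : naAlgType F) (a b c : F) (x y z : A) : A :=
  a *: (x ** (y ** z)) + b *: (y ** (z ** x)) + c *: (z ** (x ** y)).

(** Commuting the outer product gives the shape x(yz); commuting the inner one then leaves one
    monomial for each choice of outer factor. *)
Lemma multilinear3_normal (p : napoly F) :
    (forall m, m \in msupp p -> perm_eq (mvars m) (iota 0 3)) ->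
  exists a b c : F, forall A, sign_commutative A -> forall v : nat -> A,
    na_eval v p = cyclic_combination a b c (v 0%N) (v 1%N) (v 2%N).
Proof.
pose e i j k := NaMul (NaVar i) (NaMul (NaVar j) (NaVar k)).
pose es := [:: e 0 1 2; e 1 2 0; e 2 0 1]%N.
move=> pm; have [//|m mp|c cP] := @na_eval_span F sign_commutative es p;
  last first.
  exists (c (e 0 1 2)%N), (c (e 1 2 0)%N), (c (e 2 0 1)%N) => A CA v.
  by rewrite cP // !big_cons big_nil addr0 addrA.
have eP i j k : perm_eq [:: i; j; k] [:: 0; 1; 2]%N ->
    exists2 m, m \in es & exists a : F, forall A, sign_commutative A ->
       forall v : nat -> A, mon_eval v (e i j k) = a *: mon_eval v m.
  move=> pijk; have : uniq [:: i; j; k] by rewrite (perm_uniq pijk).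
  have : [/\ i \in [:: 0; 1; 2]%N, j \in [:: 0; 1; 2]%N & k \in [:: 0; 1; 2]%N].
    by rewrite -!(perm_mem pijk) !inE !eqxx !orbT.
  rewrite !inE => -[/or3P[] /eqP -> /or3P[] /eqP -> /or3P[] /eqP ->] // _;
    match goal with |- context [mon_eval _ (e ?a ?b ?c)] =>
      (exists (e a b c); [by [] | by exists 1 => A _ v; rewrite scale1r]) ||
      (exists (e a c b); [by [] | exists eps => A CA v /=;
        by rewrite (CA (v b) (v c)) namulZr]) end.
have /[dup] /perm_size /namon_deg3 [i [j [k [->|->]]]] := pm m mp.
  exact: eP.
(* The monomial (ij)k equals [eps] times k(ij), whence the order of the arguments and the factor
   [eps * a]. *)
move=> /= pijk; have [|m' m'es [a aP]] := eP k i j.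
  by rewrite -(perm_rcons k [:: i; j]).
exists m' => //; exists (eps * a) => A CA v.
by rewrite /= CA -scalerA -aP.
Qed.

(** A product of three elements sees only their coefficients of t, as t^4 = 0. *)
Lemma cyclic_combination_trunc A a b c (x y z : truncation A) :
  cyclic_combination a b c x y z =
  (0, 0, cyclic_combination a b c x.1.1 y.1.1 z.1.1).
Proof.
case: x y z => [[x1 x2] x3] [[y1 y2] y3] [[z1 z2] z3].
rewrite /cyclic_combination !truncM /trunc_mul /= !truncZ.
by rewrite !namul0r !scaler0 !addr0; congr (_, _, _); rewrite /= !addr0.
Qed.

(** * Classification by the identities of degree 3 *)

Section Classification.
Variable V : naClass F.
Hypotheses (Vop : operadic V) (Vquad : quadratic V).
Hypothesis Vsign : forall A, V A -> sign_commutative A.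
Hypothesis VnAb : ~ same_class V (@AbAlg F).

(** Monomials of degree 2 or 3 are products, so they vanish in an abelian algebra. *)
Lemma AbAlg_sub A : AbAlg A -> V A.
Proof.
move=> Aab; apply/(quadratic_models Vop Vquad) => p [_ pdeg] v.
rewrite /na_eval /linext big_seq big1 // => m /pdeg.
case: m => [i []//|m1 m2 _]; by rewrite /= Aab scaler0.
Qed.

Lemma member_of_multilinear3 A : sign_commutative A ->
    (forall a b c,
      (forall B, V B -> forall x y z : B, cyclic_combination a b c x y z = 0) ->
      forall x y z : A, cyclic_combination a b c x y z = 0) ->
  V A.
Proof.
move=> AC A3; have tA := sign_commutative_trunc AC.
suff: V (truncation A).
  move=> /(quadratic_models Vop Vquad) tAV.
  apply/(quadratic_models Vop Vquad) => p /[dup] pI [_ pdeg] w.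
  exact: na_eval_trunc_gen pdeg (tAV _ pI _).
have [S [Smul SV]] := Vop; apply/SV => p Sp v.
have pV B : V B -> identity_in B p by move=> /SV; apply.
have [n pn] := Smul p Sp; case: n pn => [|[|[|[|n]]]] pn.
(* No monomial has degree 0, so here [p] has empty support. *)
- rewrite /na_eval /linext big_seq big1 // => m /pn /perm_size /= m0.
  by have := namon_deg_gt0 m; rewrite /namon_deg m0.
(* V contains the one-dimensional zero algebra, where the value of [p] at 1 is [a]. *)
- have [a aP] := multilinear1_normal pn.
  suff a0 : a = 0 by rewrite aP a0 scale0r.
  have := pV (zero_algebra F^o) (AbAlg_sub _) (fun=> 1).
  by rewrite aP /GRing.scale /= mulr1; apply => x y.
(* With [a] nonzero, V would satisfy xy = 0 and be [AbAlg]. *)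
- have [a aP] := multilinear2_normal pn; rewrite aP //.
  have [->|a0] := eqVneq a 0; first by rewrite scale0r.
  case: VnAb => B; split=> [VB x y|]; last exact: AbAlg_sub.
  have /eqP := pV B VB (fun i => if i is 0%N then x else y).
  by rewrite aP ?scaler_eq0 ?(negPf a0); [move/eqP|exact: Vsign].
- have [a [b [c abcP]]] := multilinear3_normal pn; rewrite abcP //.
  rewrite cyclic_combination_trunc A3 // => B VB x y z.
  rewrite -(pV B VB (fun i => nth x [:: x; y; z] i)) abcP //; exact: Vsign.
(* In degree at least 4 every monomial vanishes because t^4 = 0. *)
- rewrite /na_eval /linext big_seq big1 // => m /pn /perm_size /= sm.
  have [h1 h2 h3] := mon_eval_trunc v m; move: h1 h2 h3.
  have -> : namon_deg m = n.+4 by rewrite /namon_deg sm size_iota.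
  case: (mon_eval v m) => [[y1 y2] y3] /= -> // -> // -> //.
  by rewrite truncZ !scaler0.
Qed.


Definition jacobi : naClass F := fun A =>
  forall x y z : A, x ** (y ** z) + y ** (z ** x) + z ** (x ** y) = 0.

(** The common form of associativity for [eps] = 1 and of anti-associativity for [eps] = -1. *)
Definition cyclic_product : naClass F := fun A =>
  forall x y z : A, x ** (y ** z) = y ** (z ** x).

Definition nilpotent2 : naClass F := fun A =>
  forall x y z : A, x ** (y ** z) = 0.

(** Action of the transposition of x and y: reversing the inner products yields a common factor
    [eps], which [eps2] removes. *)
Lemma cyclic_combinationC (A : naAlgType F) (a b c : F) : sign_commutative A ->
    (forall x y z : A, cyclic_combination a b c x y z = 0) ->
  forall x y z : A, cyclic_combination b a c x y z = 0.
Proof.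
move=> AC h x y z; have := congr1 ( *:%R eps) (h y x z).
rewrite scaler0 /cyclic_combination => <-.
rewrite (AC x z) (AC z y) (AC y x) !namulZr !scalerDr !scalerA.
by rewrite !(mulrAC eps _ eps) eps2 !mul1r (addrC (a *: _)).
Qed.

Lemma cyclic_combination_rot (A : naAlgType F) (a b c : F) :
    (forall x y z : A, cyclic_combination a b c x y z = 0) ->
  forall x y z : A, cyclic_combination c a b x y z = 0.
Proof.
move=> h x y z; rewrite -(h y z x) /cyclic_combination.
by rewrite -addrA addrC.
Qed.

(** Subtracting the identity transposed in its first two coefficients leaves (a - b)(x(yz) - y(zx))
    = 0. *)
Lemma cyclic_product_of_neq (A : naAlgType F) (a b c : F) :
    sign_commutative A -> a != b ->
    (forall x y z : A, cyclic_combination a b c x y z = 0) ->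
  cyclic_product A.
Proof.
move=> AC ab h x y z.
have := h x y z; have := cyclic_combinationC AC h x y z.
rewrite /cyclic_combination => <- /addIr e; apply/eqP; rewrite -subr_eq0.
have : (a - b) *: (x ** (y ** z) - y ** (z ** x)) == 0.
  by rewrite scalerBr !scalerBl opprB addrACA -opprD e subrr.
by rewrite scaler_eq0 [a - b == 0]subr_eq0 (negPf ab).
Qed.

Lemma cyclic_combination_const (A : naAlgType F) (a : F) (x y z : A) :
  cyclic_combination a a a x y z =
  a *: (x ** (y ** z) + y ** (z ** x) + z ** (x ** y)).
Proof. by rewrite !scalerDr. Qed.

Lemma cyclic_combination_sum (A : naAlgType F) (a b c : F) (x y z : A) :
  cyclic_product A ->
  cyclic_combination a b c x y z = (a + b + c) *: (x ** (y ** z)).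
Proof.
by move=> AT; rewrite /cyclic_combination (AT z) (AT x) (AT y) -!scalerDl.
Qed.

(** Nilpotency is tested first. Otherwise, under [cyclic_product], every identity of V has
    coefficient sum zero, and V contains all models of [cyclic_product]. There [jacobi] reads 3x(yz)
    = 0, so the third alternative is reached only in characteristic 3. *)
Lemma classification : ~ (forall A, sign_commutative A -> V A) ->
  [\/ same_class V (class_meet sign_commutative jacobi),
      same_class V (class_meet sign_commutative cyclic_product),
      same_class V
        (class_meet sign_commutative (class_meet jacobi cyclic_product))
    | same_class V (class_meet sign_commutative nilpotent2)].
Proof.
move=> nall.
have [N|nN] := classic (forall A, V A -> nilpotent2 A).
  constructor 4 => A; split=> [VA|[AC AN]].
    by split; [exact: Vsign|exact: N].
  apply: member_of_multilinear3 => // a b c _ x y z.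
  by rewrite /cyclic_combination !AN !scaler0 !addr0.
have [T|nT] := classic (forall A, V A -> cyclic_product A).
  have VT A : sign_commutative A -> cyclic_product A -> V A.
    move=> AC AT; apply: member_of_multilinear3 => // a b c h x y z.
    rewrite cyclic_combination_sum //; have [->|s0] := eqVneq (a + b + c) 0.
      by rewrite scale0r.
    case: nN => B VB x' y' z'; have /eqP := h B VB x' y' z'.
    rewrite cyclic_combination_sum; last exact: T.
    by rewrite scaler_eq0 (negPf s0) => /eqP.
  have [J|nJ] := classic (forall A, V A -> jacobi A).
    constructor 3 => A; split=> [VA|[AC [_ AT]]]; last exact: VT.
    by split; [exact: Vsign|split; [exact: J|exact: T]].
  constructor 2 => A; split=> [VA|[AC AT]]; last exact: VT.
  by split; [exact: Vsign|exact: T].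
(* Since [cyclic_product] fails in V, no identity of V has two distinct coefficients; two rotations
   bring [b] and [c] to the front. *)
have const a b c :
    (forall B, V B -> forall x y z : B, cyclic_combination a b c x y z = 0) ->
  a = b /\ b = c.
  move=> h; split; apply/eqP; apply: contra_notT nT => neq B VB.
    exact: cyclic_product_of_neq (Vsign VB) neq (h B VB).
  apply: (cyclic_product_of_neq (Vsign VB) neq (c := a)).
  exact/cyclic_combination_rot/cyclic_combination_rot/h.
constructor 1.
have [J|nJ] := classic (forall A, V A -> jacobi A).
  move=> A; split=> [VA|[AC AJ]]; first by split; [exact: Vsign|exact: J].
  apply: member_of_multilinear3 => // a b c /const [<- <-] x y z.
  by rewrite cyclic_combination_const AJ scaler0.
(* Without [jacobi], the constant coefficient must be zero: V has no nontrivial identity of degree 3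
   and contains all sign-commutative algebras. *)
case: nall => A AC; apply: member_of_multilinear3 => // a b c h x y z.
have [ab bc] := const _ _ _ h; rewrite -bc -ab in h *.
rewrite cyclic_combination_const; have [->|a0] := eqVneq a 0.
  by rewrite scale0r.
case: nJ => B VB x' y' z'; have /eqP := h B VB x' y' z'.
by rewrite cyclic_combination_const scaler_eq0 (negPf a0) => /eqP.
Qed.

End Classification.

End CommutationSign.

(** * Morphisms of split extensions, and extensions of a square-zero line *)

Section Homomorphisms.
Variable F : fieldType.

Lemma scalar_linear (B : lmodType F) (w : {linear B -> F^o}) a b c :
  w (a *: b + c) = a * w b + w c.
Proof. exact: linearP. Qed.

Definition mk_naHom (A B : naAlgType F) (f : A -> B) (f_lin : linear f)
    (fM : {morph f : x y / x ** y}) : naHom A B :=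
  @NaHom F A B
    (HB.pack f (GRing.isLinear.Build F A B *:%R f f_lin) : {linear A -> B}) fM.

Lemma comp_lin (A B C : naAlgType F) (g : naHom B C) (f : naHom A B) :
  linear (g \o f).
Proof. by move=> a x y /=; rewrite !linearP. Qed.

Lemma comp_mul (A B C : naAlgType F) (g : naHom B C) (f : naHom A B) :
  {morph g \o f : x y / x ** y}.
Proof. by move=> x y /=; rewrite !naHomM. Qed.

Definition comp_naHom (A B C : naAlgType F) (g : naHom B C) (f : naHom A B) :=
  mk_naHom (comp_lin g f) (comp_mul g f).

Lemma comp_splitExtHom (V : naClass F) (X : naAlgType F)
    (E1 E2 E3 : splitExt V X) (g : splitExtHom E2 E3) (f : splitExtHom E1 E2) :
  exists h : splitExtHom E1 E3, seh_base h =1 seh_base g \o seh_base f.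
Proof.
unshelve eexists (@SplitExtHom _ _ _ _ _
  (comp_naHom (seh_mid g) (seh_mid f)) (comp_naHom (seh_base g) (seh_base f))
  _ _ _) => //=.
- by move=> x /=; rewrite !seh_k.
- by move=> x /=; rewrite !seh_alpha.
- by move=> x /=; rewrite !seh_beta.
Qed.

End Homomorphisms.

(** With [eps = 1] or [-1], the square-zero algebra [F] is extended by [B]: each
    [b] acts on it on the left by [w b] and on the right by [eps * w b]. No
    compatibility between [w] and the product of [B] is required. [eps] is a
    phantom parameter of the type, recording which product it carries. *)
Section Semidirect.
Variables (F : fieldType) (eps : F).

Definition semidirect (e : F) (B : naAlgType F)
    (w : {linear B -> F^o}) : Type :=
  (zero_algebra F^o * B)%type.

HB.instance Definition _ B w := GRing.Lmodule.on (@semidirect eps B w).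

Variables (B : naAlgType F) (w : {linear B -> F^o}).
Local Notation A := (semidirect eps w).

Definition semidirect_mul (x y : A) : A :=
  (w x.2 *: y.1 + (eps * w y.2) *: x.1, x.2 ** y.2).

Lemma semidirect_mul_linl a x y z :
  semidirect_mul (a *: x + y) z = a *: semidirect_mul x z + semidirect_mul y z.
Proof.
case: x y z => [x b] [y c] [z d]; rewrite /semidirect_mul /=.
rewrite namul_linl (scalar_linear w); congr (_, _) => /=.
rewrite !(scalerDr, scalerDl) !scalerA addrACA.
by rewrite [eps * w d * a]mulrC.
Qed.

Lemma semidirect_mul_linr a x y z :
  semidirect_mul z (a *: x + y) = a *: semidirect_mul z x + semidirect_mul z y.
Proof.
case: x y z => [x b] [y c] [z d]; rewrite /semidirect_mul /=.
rewrite namul_linr (scalar_linear w); congr (_, _) => /=.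
rewrite mulrDr !(scalerDr, scalerDl) !scalerA addrACA.
by rewrite [w d * a]mulrC [eps * (a * _)]mulrCA.
Qed.

HB.instance Definition _ :=
  Lmodule_isNaAlgebra.Build F A semidirect_mul_linl semidirect_mul_linr.


Lemma semidirectM (x y : A) : x ** y = semidirect_mul x y.
Proof. by []. Qed.

Hypothesis eps2 : eps * eps = 1.

Lemma sign_commutative_zero (M : lmodType F) :
  sign_commutative eps (zero_algebra M).
Proof. by move=> x y; rewrite !zero_mulE scaler0. Qed.

Lemma sign_commutative_semidirect :
  sign_commutative eps B -> sign_commutative eps A.
Proof.
move=> BC [x b] [y c]; rewrite !semidirectM /semidirect_mul /=.
rewrite BC; congr (_, _); rewrite /= scalerDr !scalerA mulrA eps2 mul1r.
by rewrite addrC.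
Qed.

Definition semidirect_in (x : zero_algebra F^o) : A := (x, 0).
Definition semidirect_pr (x : A) : B := x.2.
Definition semidirect_sec (b : B) : A := (0, b).

Lemma semidirect_in_lin : linear semidirect_in.
Proof. by move=> a x y; congr (_, _); rewrite /= scaler0 addr0. Qed.

Lemma semidirect_inM : {morph semidirect_in : x y / x ** y}.
Proof.
move=> x y; rewrite semidirectM /semidirect_mul /= namul0l linear0.
by rewrite mulr0 !scale0r addr0.
Qed.

Lemma semidirect_pr_lin : linear semidirect_pr.
Proof. by []. Qed.

Lemma semidirect_prM : {morph semidirect_pr : x y / x ** y}.
Proof. by []. Qed.

Lemma semidirect_sec_lin : linear semidirect_sec.
Proof. by move=> a x y; congr (_, _); rewrite /= scaler0 addr0. Qed.

Lemma semidirect_secM : {morph semidirect_sec : x y / x ** y}.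
Proof.
by move=> x y; rewrite semidirectM /semidirect_mul /= !scaler0 addr0.
Qed.

(** A morphism killed by the projection has zero second component, so its first component factors
    it. That component is multiplicative because [w 0 = 0] makes products of such elements
    vanish. *)
Lemma semidirect_kernel (V : naClass F) :
  is_kernel V (mk_naHom semidirect_in_lin semidirect_inM)
    (mk_naHom semidirect_pr_lin semidirect_prM).
Proof.
split=> // C f _ f0.
have fst_lin : linear (fun c => (f c).1 : zero_algebra F^o).
  by move=> a x y; rewrite linearP.
have fstM : {morph (fun c => (f c).1 : zero_algebra F^o) : x y / x ** y}.
  move=> x y; rewrite naHomM semidirectM /semidirect_mul /=.
  have /= f2 c : (f c).2 = 0 := f0 c.
  by rewrite !f2 linear0 mulr0 !scale0r addr0.
exists (mk_naHom fst_lin fstM); split=> [c|g gf c] /=.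
  by have /= f2 := f0 c; case: (f c) f2 => u u' /= ->.
by rewrite -gf.
Qed.

Definition semidirect_ext (V : naClass F) (VA : V A) (VB : V B) :
    splitExt V (zero_algebra F^o) :=
  SplitExt VA VB (fun=> erefl : mk_naHom semidirect_pr_lin semidirect_prM
    (mk_naHom semidirect_sec_lin semidirect_secM _) = _) (semidirect_kernel V).

End Semidirect.

(** * Failure of action accessibility for all sign-commutative algebras *)

Section NotActionAccessible.
Variables (F : fieldType) (eps : F).
Hypothesis eps2 : eps * eps = 1.

(** The basis [u], [d], [v] with [u ** d = v], [d ** u = eps *: v] and all other
    products zero. *)
Definition base_algebra_of (e : F) : Type := (F^o * F^o * F^o)%type.

Local Notation base_algebra := (base_algebra_of eps).

HB.instance Definition _ := GRing.Lmodule.on base_algebra.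

Definition base_mul (x y : base_algebra) : base_algebra :=
  (0, 0, x.1.1 * y.1.2 + eps * (y.1.1 * x.1.2)).

Lemma base_mul_linl a x y z :
  base_mul (a *: x + y) z = a *: base_mul x z + base_mul y z.
Proof.
case: x y z => [[x1 x2] x3] [[y1 y2] y3] [[z1 z2] z3].
congr (_, _, _); rewrite /= ?scaler0 ?addr0 // /GRing.scale /=.
by ring.
Qed.

Lemma base_mul_linr a x y z :
  base_mul z (a *: x + y) = a *: base_mul z x + base_mul z y.
Proof.
case: x y z => [[x1 x2] x3] [[y1 y2] y3] [[z1 z2] z3].
congr (_, _, _); rewrite /= ?scaler0 ?addr0 // /GRing.scale /=.
by ring.
Qed.

HB.instance Definition _ :=
  Lmodule_isNaAlgebra.Build F base_algebra base_mul_linl base_mul_linr.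

Lemma sign_commutative_base : sign_commutative eps base_algebra.
Proof.
move=> x y; congr (_, _, _) => /=; rewrite ?scaler0 // /GRing.scale /=.
by rewrite mulrDr [eps * (eps * _)]mulrA eps2 mul1r addrC.
Qed.


(** The weight kills [u] and [d] but not their product [v]; this incompatibility with the product
    drives the counterexample. *)
Definition base_weight (x : base_algebra) : F^o := x.2.

Lemma base_weight_lin : linear base_weight. Proof. by []. Qed.

HB.instance Definition _ :=
  GRing.isLinear.Build F base_algebra F^o *:%R base_weight base_weight_lin.

(** The two maps [t |-> u] and [t |-> 0] from the square-zero line, acting
    trivially, are compatible with the actions, so every morphism into a
    faithful extension kills [u], hence also [v = u ** d], although [v] acts as
    the identity. *)
Lemma not_action_accessible (V : naClass F) :
    (forall A, sign_commutative eps A -> V A) ->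
    (forall A, V A -> sign_commutative eps A) ->
  ~ action_accessible V.
Proof.
move=> VC CV Vacc.
pose w0 : {linear zero_algebra F^o -> F^o} := \0.
pose w : {linear base_algebra -> F^o} := base_weight.
pose zc M : sign_commutative eps (zero_algebra M) :=
  @sign_commutative_zero F eps M.
have bc := sign_commutative_base.
pose E0 := semidirect_ext
  (VC _ (sign_commutative_semidirect (w := w0) eps2 (zc _))) (VC _ (zc _)).
pose E := semidirect_ext
  (VC _ (sign_commutative_semidirect (w := w) eps2 bc)) (VC _ bc).
have [E' [faith [h]]] := Vacc _ (VC _ (zc _)) E.
(* Multiplicative since [u ** u = 0]; the two maps to compare are [g 0] and [g 1]. *)
pose g (a : F) (t : zero_algebra F^o) : base_algebra := (a * t, 0, 0).
have g_lin a : linear (g a).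
  move=> b x y; congr (_, _, _); rewrite /= ?scaler0 ?addr0 //.
  by rewrite /GRing.scale /=; ring.
have gM a : {morph g a : x y / x ** y}.
  move=> x y; congr (_, _, _) => /=; rewrite ?mulr0 ?mul0r //.
  by rewrite addr0.
(* The identity on the kernel respects both actions, as multiples of [u] have weight zero. *)
pose gm a (x : semidirect eps w0) : semidirect eps w := (x.1, g a x.2).
have gm_lin a : linear (gm a).
  by move=> b x y; congr (_, _); apply: g_lin.
have gmM a : {morph gm a : x y / x ** y}.
  move=> x y; rewrite !semidirectM /semidirect_mul /gm /= -gM.
  by rewrite /base_weight /= !mulr0 !scale0r.
have gh a : exists f : splitExtHom E0 E, seh_base f =1 g a.
  unshelve eexists (@SplitExtHom _ _ _ E0 E
    (mk_naHom (@gm_lin a) (@gmM a)) (mk_naHom (@g_lin a) (@gM a)) _ _ _) => //=.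
  by move=> x; congr (_, (_, _, _)); rewrite /= mulr0.
have [f0 f0E] := gh 0; have [f1 f1E] := gh 1.
have [h0 h0E] := comp_splitExtHom h f0; have [h1 h1E] := comp_splitExtHom h f1.
(* Faithfulness equates the two composites; their base maps at 1 are the images under [h] of 0 and
   of [u]. *)
have [_ /(_ 1)] := faith _ h0 h1; rewrite h0E h1E /= f0E f1E.
have -> : g 0 1 = 0 by rewrite /g mul0r.
rewrite linear0 => /esym hu.
pose d : base_algebra := (0, 1, 0); pose v : base_algebra := (0, 0, 1).
have hv : seh_base h v = 0.
  have -> : v = g 1 1 ** d.
    by congr (_, _, _); rewrite /= !mulr1 mul0r mulr0 addr0.
  by rewrite naHomM hu namul0l.
(* Left multiplication by [v] fixes the kernel element 1, while [h] sends [v] to zero. *)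
have k1 : se_k E' 1 = 0.
  rewrite -(seh_k h).
  have -> : se_k E 1 = se_beta E v ** se_k E 1.
    rewrite /= semidirectM /semidirect_mul /= /base_weight /= scale1r mulr0.
    by rewrite scale0r addr0 namul0r.
  by rewrite naHomM seh_beta hv linear0 namul0l.
have k0 x : se_k E' x = 0.
  by rewrite -[x]mulr1 -[x * 1]/(x *: (1 : zero_algebra F^o))
    linearZ /= k1 scaler0.
(* As [se_k E'] is zero, it factors through itself by the identity and by the zero map, against the
   uniqueness required of a kernel. *)
have id_lin : linear (id : zero_algebra F^o -> zero_algebra F^o) by [].
have idM : {morph (id : zero_algebra F^o -> zero_algebra F^o) : x y / x ** y}.
  by [].
pose nul (_ : zero_algebra F^o) : zero_algebra F^o := 0.
have nul_lin : linear nul by move=> a x y; rewrite scaler0 addr0.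
have nulM : {morph nul : x y / x ** y} by [].
have [ker0 ker] := se_kernel E'.
have [i [_ iP]] := ker _ (se_k E') (VC _ (zc _)) ker0.
have := iP (mk_naHom id_lin idM) (fun=> erefl) 1.
rewrite -(iP (mk_naHom nul_lin nulM)) /= => [/eqP|x];
  last by rewrite linear0 k0.
by rewrite oner_eq0.
Qed.

End NotActionAccessible.

(** * Translation into the named varieties *)

Theorem corollary2p3 (F : fieldType) (V : naClass F)
    (hvar : is_variety V) (hacc : action_accessible V)
    (hop : operadic V) (hquad : quadratic V)
    (hab : ~ same_class V (@AbAlg F)) :
  ((forall A : naAlgType F, V A -> is_commutative A) ->
     same_class V (@JJord F) \/
     same_class V (@CAssoc F) \/
     same_class V (class_meet (@JJord F) (@CAssoc F)) \/
     same_class V (@Nil2Com F)) /\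
  ((forall A : naAlgType F, V A -> is_anticommutative A) ->
     same_class V (@Lie F) \/
     same_class V (@ACAAssoc F) \/
     same_class V (class_meet (@Lie F) (@ACAAssoc F)) \/
     same_class V (@Nil2ACom F)).
Proof.
have same_trans (W1 W2 W3 : naClass F) :
    same_class W1 W2 -> same_class W2 W3 -> same_class W1 W3.
  by move=> h12 h23 A; rewrite h12.
split=> hcomm.
- have eps2 : 1 * 1 = 1 :> F by rewrite mulr1.
  have commE A : sign_commutative (1 : F) A <-> is_commutative A.
    by split=> hC x y; have := hC x y; rewrite scale1r.
  have VC A : V A -> sign_commutative (1 : F) A by move=> /hcomm /commE.
  (* By commutativity (xy)z = z(xy), so associativity is invariance of x(yz) under rotation. *)
  have assocE (A : naAlgType F) : is_commutative A -> (cyclic_product A <->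
      forall x y z : A, x ** (y ** z) = (x ** y) ** z).
    move=> hC; split=> h x y z; first by rewrite [RHS]hC -h.
    by rewrite h hC h hC.
  have nilE (A : naAlgType F) : is_commutative A -> (nilpotent2 A <->
      forall x y z : A, x ** (y ** z) = 0 /\ (x ** y) ** z = 0).
    by move=> hC; split=> h x y z; [split; last rewrite hC|have [] := h x y z].
  have [||||] := classification eps2 hop hquad VC hab.
  + by move=> CV; exact (not_action_accessible eps2 CV VC hacc).
  + move=> hV; left; apply: (same_trans _ _ _ hV) => A.
    by split=> -[/commE ? ?].
  + move=> hV; right; left; apply: (same_trans _ _ _ hV) => A; split.
      by move=> [/commE hC /(assocE _ hC) hA].
    by move=> [hC /(assocE _ hC) hT]; split; first exact/commE.
  + move=> hV; right; right; left; apply: (same_trans _ _ _ hV) => A; split.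
      by move=> [/commE hC [hJ /(assocE _ hC) hA]].
    by move=> [[hC hJ] [_ /(assocE _ hC) hT]]; split; first exact/commE.
  + move=> hV; right; right; right; apply: (same_trans _ _ _ hV) => A; split.
      by move=> [/commE hC /(nilE _ hC) hN].
    by move=> [hC /(nilE _ hC) hN]; split; first exact/commE.
- have eps2 : -1 * -1 = 1 :> F by rewrite mulrNN mulr1.
  have commE A : sign_commutative (-1 : F) A <-> is_anticommutative A.
    by split=> hC x y; have := hC x y; rewrite scaleN1r.
  have VC A : V A -> sign_commutative (-1 : F) A by move=> /hcomm /commE.
  have lieE (A : naAlgType F) : is_anticommutative A <->
      forall x y : A, x ** y + y ** x = 0.
    by split=> hC x y; [rewrite hC addNr|apply/eqP; rewrite -addr_eq0 hC].
  (* Here -(xy)z = z(xy), so anti-associativity is again invariance under rotation. *)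
  have assocE (A : naAlgType F) : is_anticommutative A -> (cyclic_product A <->
      forall x y z : A, x ** (y ** z) = - ((x ** y) ** z)).
    by move=> hC; split=> h x y z; [rewrite -hC -h|rewrite h -hC h -hC].
  have nilE (A : naAlgType F) : is_anticommutative A -> (nilpotent2 A <->
      forall x y z : A, x ** (y ** z) = 0 /\ (x ** y) ** z = 0).
    move=> hC; split=> h x y z; last by have [] := h x y z.
    by split; last rewrite hC h oppr0.
  have [||||] := classification eps2 hop hquad VC hab.
  + by move=> CV; exact (not_action_accessible eps2 CV VC hacc).
  + move=> hV; left; apply: (same_trans _ _ _ hV) => A; split.
      by move=> [/commE /lieE].
    by move=> [/lieE /commE].
  + move=> hV; right; left; apply: (same_trans _ _ _ hV) => A; split.
      by move=> [/commE hC /(assocE _ hC) hA].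
    by move=> [hC /(assocE _ hC) hT]; split; first exact/commE.
  + move=> hV; right; right; left; apply: (same_trans _ _ _ hV) => A; split.
      by move=> [/commE hC [hJ /(assocE _ hC) hA]]; do 2?split=> //; exact/lieE.
    by move=> [[_ hJ] [hC /(assocE _ hC) hT]]; split; first exact/commE.
  + move=> hV; right; right; right; apply: (same_trans _ _ _ hV) => A; split.
      by move=> [/commE hC /(nilE _ hC) hN].
    by move=> [hC /(nilE _ hC) hN]; split; first exact/commE.
Qed.
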